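(* Let $A$ be an abelian group of order $n$ and let $B=A\rtimes\langle\iota\rangle$. Then the ratio of the number of isomorphism classes of Cayley graphs $\mathrm{Cay}(A,S)$ ($S$ inverse-closed) with $\mathrm{Aut}(\mathrm{Cay}(A,S))=B$ to the number of isomorphism classes of Cayley graphs on $A$ tends to $1$ as $n\to\infty$.
   Context: All groups and graphs are finite. A digraph is a pair $(V,R)$ with $V$ finite nonempty and $R\subseteq V\times V$ (loops allowed); it is a graph if $R$ is symmetric. For a group $G$ and $S\subseteq G$, $\mathrm{Cay}(G,S)$ has vertex set $G$, with $(g,h)$ an arc iff $gh^{-1}\in S$; it is a graph iff $S=S^{-1}$. For abelian $A$, $\iota:A\to A$ is $a\mapsto a^{-1}$, and $A\rtimes\langle\iota\rangle$ is the permutation group on $A$ generated by the right translations $x\mapsto xa$ and $\iota$. Unlabeled graphs are isomorphism classes of graphs. *)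

(* Defs.v *)
From HB Require Import structures.
From mathcomp Require Import all_boot all_order all_algebra all_fingroup.
Set Implicit Arguments. Unset Strict Implicit. Unset Printing Implicit Defensive.
Import Order.TTheory GRing.Theory Num.Theory.

Section Cayley.
Variable gT : finGroupType.

Definition cay_rel (S : {set gT}) : rel gT := fun g h => (g * h^-1)%g \in S.

Definition inv_closed (S : {set gT}) : bool := [forall x, (x \in S) == (x^-1 \in S)%g].

Definition cay_aut (S : {set gT}) : {set {perm gT}} :=
  [set p : {perm gT} | [forall x, forall y, cay_rel S x y == cay_rel S (p x) (p y)]].

Definition rtrans (a : gT) : {perm gT} := perm (@mulIg gT a).
Definition iota_perm : {perm gT} := perm (@invg_inj gT).

Definition Bgrp : {set {perm gT}} :=
  <<[set rtrans a | a : gT] :|: [set iota_perm]>>%g.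

Definition cay_iso (S T : {set gT}) : bool :=
  [exists p : {perm gT}, [forall x, forall y, cay_rel S x y == cay_rel T (p x) (p y)]].

Definition cay_sets : {set {set gT}} := [set S | inv_closed S].

Definition cay_classes : {set {set {set gT}}} :=
  equivalence_partition cay_iso cay_sets.

Definition good_classes : {set {set {set gT}}} :=
  [set C in cay_classes | [exists S in C, cay_aut S == Bgrp]].

End Cayley.

(* Main.v *)
Require Import Defs.
From HB Require Import structures.
From mathcomp Require Import all_boot all_order all_algebra all_fingroup.
From mathcomp Require Import zify.
Import Order.TTheory GRing.Theory Num.Theory.
Set Implicit Arguments. Unset Strict Implicit. Unset Printing Implicit Defensive.

(** Write n for the order of the abelian group and l for log2 n.  Fix a set D of
192 l^3 elements whose quotients u v^-1 are essentially distinct (a weak Sidon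
set) and, unless the group has exponent 2, whose squares are spread out.  An
automorphism p of Cay(A, S) forces, for every pair (u, v), that u v^-1 and
p(u) p(v)^-1 are both in S or both outside; unless these two elements agree up
to inversion (otherwise the pair is called bad) this is a genuine constraint on
S, and k bad pairs with nearly distinct quotients cut the number of S by a factor
2^(k/12).  If p differs from its closest element b of B at r >= 1 points of D,
then at least |D| r / 16 pairs in D x D are bad; if p = b on D but p w <> b w,
then at least half of the pairs (w, v), v in D, are bad.  After composing with
b^-1 only the r moved points and their images matter, so n^(2r) choices compete
with a gain 2^(l^3 r), and the sets S with Aut(Cay(A, S)) <> B are a fraction
2^-(l^3 - O(l)) of all inverse-closed sets.  For the other S, a based isomorphism
Cay(A, S) -> Cay(A, T) is determined by the conjugates in B of at most l
generating translations, so isomorphism classes have size at most (2n)^l, which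
is negligible. *)

(** * Inverse-closed sets and the cost of membership constraints *)

Section Counting.
Local Open Scope group_scope.
Variable gT : finGroupType.
Implicit Types (S : {set gT}) (F : {set {set gT}}) (x y u v : gT).

(** The element of smaller rank is kept from each pair {x, x^-1}; inverse-closed sets correspond to
    arbitrary subsets of [inv_reps]. *)
Definition inv_reps : {set gT} := [set x | enum_rank x <= enum_rank x^-1].

Definition inv_rep x := if x \in inv_reps then x else x^-1.

Lemma inv_rep_in x : inv_rep x \in inv_reps.
Proof.
rewrite /inv_rep; case: ifP => // xN; move: xN; rewrite !inE invgK => /negbT.
by rewrite -ltnNge => /ltnW.
Qed.

Lemma inv_rep_id x : x \in inv_reps -> inv_rep x = x.
Proof. by rewrite /inv_rep => ->. Qed.

Lemma inv_rep_eq x y : inv_rep x = inv_rep y -> x = y \/ x = y^-1.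
Proof.
rewrite /inv_rep; case: ifP => _; case: ifP => _ E.
- by left.
- by right.
- by right; rewrite -E invgK.
- by left; apply: invg_inj.
Qed.

Lemma inv_repV x : inv_rep x^-1 = inv_rep x.
Proof.
rewrite /inv_rep !inE invgK; case: leqP => h; case: leqP => h' //.
  by apply: enum_rank_inj; apply: val_inj; apply/eqP; rewrite eqn_leq h h'.
by have := ltn_trans h h'; rewrite ltnn.
Qed.

Lemma inv_closedV S x : inv_closed S -> (x^-1 \in S) = (x \in S).
Proof. by move/forallP/(_ x)/eqP. Qed.

Lemma mem_inv_rep S x : inv_closed S -> (inv_rep x \in S) = (x \in S).
Proof. by move=> cS; rewrite /inv_rep; case: ifP => // _; apply: inv_closedV. Qed.

Lemma card_cay_sets_ge : 2 ^ #|inv_reps| <= #|cay_sets gT|.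
Proof.
rewrite -card_powerset.
have inj : {in powerset inv_reps &, injective (fun X : {set gT} => [set x | inv_rep x \in X])}.
  move=> X Y; rewrite !inE => sX sY E; apply/setP=> x.
  have [xK|xK] := boolP (x \in inv_reps).
    by have /setP/(_ x) := E; rewrite !inE inv_rep_id.
  by rewrite (contraNF (subsetP sX x) xK) (contraNF (subsetP sY x) xK).
rewrite -(card_in_imset inj); apply: subset_leq_card.
apply/subsetP=> _ /imsetP[X _ ->]; rewrite inE.
by apply/forallP=> x; rewrite !inE inv_repV.
Qed.

(* Each element of [M] carries the same bit as an earlier one, so the bits
   outside [M] determine the whole set. *)
Lemma card_constrained F (rho : gT -> nat) (M : {set gT}) :
  F \subset cay_sets gT -> M \subset inv_reps ->
  (forall a, a \in M -> exists2 b, (b \in inv_reps) && (rho b < rho a) &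
     forall S, S \in F -> (a \in S) = (b \in S)) ->
  #|F| * 2 ^ #|M| <= #|cay_sets gT|.
Proof.
move=> sF sM low; apply: leq_trans card_cay_sets_ge.
have -> : #|inv_reps| = (#|inv_reps :\: M| + #|M|)%N.
  by rewrite -(cardsID M inv_reps) addnC (setIidPr sM).
rewrite expnD leq_mul2r; apply/orP; right; rewrite -card_powerset.
have inj : {in F &, injective (fun S : {set gT} => S :&: (inv_reps :\: M))}.
  move=> S T SF TF /setP E.
  have key : forall n a, rho a < n -> a \in inv_reps -> (a \in S) = (a \in T).
    elim=> // n IH a an aK; have [aM|aM] := boolP (a \in M).
      have [b /andP[bK ba] eqb] := low a aM.
      by rewrite !eqb //; apply: IH => //; apply: leq_trans ba _.
    by have := E a; rewrite !in_setI in_setD aM aK !andbT.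
  have cl X : X \in F -> inv_closed X by move/(subsetP sF); rewrite inE.
  apply/setP=> x; rewrite -(mem_inv_rep x (cl S SF)) -(mem_inv_rep x (cl T TF)).
  by apply: (key (rho (inv_rep x)).+1) => //; apply: inv_rep_in.
rewrite -(card_in_imset inj); apply: subset_leq_card.
by apply/subsetP=> _ /imsetP[S _ ->]; rewrite inE subsetIr.
Qed.

Definition bad_pair (f : gT -> gT) u v :=
  inv_rep (u * v^-1) != inv_rep (f u * (f v)^-1).

Lemma bad_pairPn (f : gT -> gT) u v :
  ~~ bad_pair f u v ->
  f u * (f v)^-1 = u * v^-1 \/ f u * (f v)^-1 = v * u^-1.
Proof.
by rewrite negbK => /eqP/esym/inv_rep_eq; rewrite invMg invgK.
Qed.

Lemma bad_pairI (f : gT -> gT) u v :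
  f u * (f v)^-1 <> u * v^-1 -> f u * (f v)^-1 <> v * u^-1 -> bad_pair f u v.
Proof.
by move=> n1 n2; have [//|/bad_pairPn[]] := boolP (bad_pair f u v).
Qed.

Definition pair_class (e : gT * gT) := inv_rep (e.1 * e.2^-1).

Definition respecting (f : gT -> gT) (P : {set gT * gT}) :=
  [set S in cay_sets gT |
     [forall e in P, (e.1 * e.2^-1 \in S) == (f e.1 * (f e.2)^-1 \in S)]].

Lemma leq_card_fibers (I J : finType) (P : {set I}) (h : I -> J) m :
  (forall i, i \in P -> #|[set j in P | h j == h i]| <= m) ->
  #|P| <= m * #|h @: P|.
Proof.
move=> fib; rewrite -sum1_card (partition_big_imset h) /= mulnC -sum_nat_const.
apply: leq_sum => _ /imsetP[i iP ->].
apply: leq_trans (fib i iP); rewrite -sum1_card; apply: eq_leq.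
by apply: eq_bigl => j; rewrite inE.
Qed.

(** Each bad pair equates the bits of two distinct representatives. Under the rank order or its
    reverse, at least half of the pairs express the bit of [pair_class e] by an earlier one, and at
    most [m] pairs share a class; hence the factor [2 * m]. *)
Lemma card_respecting (f : gT -> gT) (P : {set gT * gT}) m k :
  0 < m ->
  (forall e, e \in P -> bad_pair f e.1 e.2) ->
  (forall e, e \in P -> #|[set e' in P | pair_class e' == pair_class e]| <= m) ->
  2 * m * k <= #|P| ->
  #|respecting f P| * 2 ^ k <= #|cay_sets gT|.
Proof.
move=> mpos bad fib kP; have [->|k0] := posnP k.
  by rewrite expn0 muln1; apply: subset_leq_card; apply/subsetP=> S; rewrite inE => /andP[].
pose img e := inv_rep (f e.1 * (f e.2)^-1).
suff main (rho : gT -> nat) (Q : {set gT * gT}) : Q \subset P -> m * k <= #|Q| ->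
    (forall e, e \in Q -> rho (img e) < rho (pair_class e)) ->
    #|respecting f P| * 2 ^ k <= #|cay_sets gT|.
  pose lo := [set e in P | enum_rank (img e) < enum_rank (pair_class e)].
  pose hi := [set e in P | enum_rank (pair_class e) < enum_rank (img e)].
  have Psub : P \subset lo :|: hi.
    apply/subsetP=> e eP; rewrite !inE eP /= -neq_ltn.
    apply: contraNneq (bad e eP) => E; rewrite /bad_pair; apply/eqP.
    by apply: enum_rank_inj; apply: val_inj.
  have := leq_trans (subset_leq_card Psub) (leq_card_setU lo hi).
  have [h _|h hP] := leqP (m * k) #|lo|.
    apply: (main (fun x => enum_rank x) lo) => // [|e]; last by rewrite inE => /andP[].
    by apply/subsetP=> e; rewrite inE => /andP[].
  (* Reversing the order keeps [pair_class e] as the eliminated side, the one whose multiplicity is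
     bounded. *)
  apply: (main (fun x => #|gT| - enum_rank x)%N hi) => [||e].
  - by apply/subsetP=> e; rewrite inE => /andP[].
  - by move: kP; rewrite -mulnA; lia.
  rewrite inE => /andP[_ lt]; apply: ltn_sub2l => //; apply: leq_trans (ltn_ord _) _.
move=> sQ kQ lt.
have sC : pair_class @: Q \subset inv_reps.
  by apply/subsetP=> _ /imsetP[e _ ->]; apply: inv_rep_in.
have cQ : #|Q| <= m * #|pair_class @: Q|.
  apply: leq_card_fibers => e eQ; apply: leq_trans (fib e (subsetP sQ e eQ)).
  by apply/subset_leq_card/subsetP=> e'; rewrite !inE => /andP[/(subsetP sQ)->].
apply: leq_trans (_ : #|respecting f P| * 2 ^ #|pair_class @: Q| <= _).
  rewrite leq_mul2l leq_exp2l //; apply/orP; right.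
  by rewrite -(leq_pmul2l mpos); apply: leq_trans kQ cQ.
apply: (card_constrained (rho := rho)) => //.
  by apply/subsetP=> S; rewrite inE => /andP[].
move=> _ /imsetP[e eQ ->]; exists (img e); first by rewrite inv_rep_in lt.
move=> S; rewrite !inE => /andP[cS /forall_inP/(_ e (subsetP sQ e eQ))/eqP E].
by rewrite !mem_inv_rep.
Qed.
End Counting.

(** * Maps far from every dihedral map have many bad pairs *)

Section Stability.
Local Open Scope group_scope.
Variable gT : finGroupType.
Hypothesis mC : @commutative gT gT mulg.
Implicit Types (x y u v w : gT) (D : {set gT}).

(* As [e] and [a] vary, these maps are exactly the elements of [Bgrp gT]. *)
Definition dihedral_map (e : bool) (a x : gT) := (if e then x^-1 else x) * a.

Definition spread_squares D :=
  (forall x, x * x = 1) \/ (forall s, 2 * #|[set x in D | x * x == s]| <= #|D|).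

Definition bad_pairs (f : gT -> gT) (E D : {set gT}) :=
  [set e in setX E D | bad_pair f e.1 e.2].

Lemma card_bad_pairs f E D :
  #|bad_pairs f E D| = \sum_(u in E) #|[set v in D | bad_pair f u v]|.
Proof.
rewrite -sum1_card; under [RHS]eq_bigr do rewrite -sum1_card.
rewrite pair_big_dep /=; apply: eq_bigl => -[u v].
by rewrite !inE /= andbA.
Qed.

(** With [y = f u], the right-hand equation compares the translation and the reflection that agree
    with [f] at [u]. *)
Lemma sqr_eqP x u y :
  x * x = u * u <-> x * (u^-1 * y) = x^-1 * (u * y).
Proof.
split=> [E|]; last first.
  by rewrite !mulgA => /mulIg E; rewrite -{2}(mulgKV u x) E !mulgA mulgV mul1g.
by rewrite !mulgA; congr (_ * y); apply: (mulgI x); rewrite !mulgA E mulgK mulgV mul1g.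
Qed.

(** The image quotient is [x^-1 * u^2 * y^-1], which equals [x * y^-1] only if [x^2 = u^2], and
    [y * x^-1] only if [y^2 = u^2]. *)
Lemma bad_dihedral f u x y :
  f x = x^-1 * (u * f u) -> f y = y * (u^-1 * f u) ->
  x * x <> u * u -> y * y <> u * u -> bad_pair f x y.
Proof.
move=> fx fy nx ny.
have E : f x * (f y)^-1 = x^-1 * (u * u) * y^-1.
  by rewrite fx fy !invMg invgK !mulgA mulgK.
apply: bad_pairI; rewrite E.
  by move/mulIg => E'; apply: nx; rewrite -{2}E' mulgA mulgV mul1g.
rewrite (mC y) -mulgA => /mulgI E'; apply: ny.
by rewrite -{1}E' mulgKV.
Qed.

(** Take [u] with the smallest set [Z u] of bad partners. Every other [v] lies on the translation or
    the reflection through [(u, f u)]; [X] and [Y] are the points off these maps. So [X :\: Z u]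
    follows the reflection, [Y :\: Z u] the translation, and every pair between them is bad. Either
    [Z u] is large, hence every [Z v] is, or this rectangle is large. *)
Lemma stability (D : {set gT}) (f : gT -> gT) r :
  spread_squares D ->
  (forall e a, r <= #|[set x in D | f x != dihedral_map e a x]|) ->
  #|D| * r <= 16 * #|bad_pairs f D D|.
Proof.
move=> spr far; have [->|[u1 u1D]] := set_0Vmem D; first by rewrite cards0.
pose Z u := [set v in D | bad_pair f u v].
have [u uD umin] : exists2 u, u \in D & forall v, v \in D -> #|Z u| <= #|Z v|.
  by case: (arg_minnP (fun u => #|Z u|) u1D) => u uD umin; exists u.
have ZB : #|D| * #|Z u| <= #|bad_pairs f D D|.
  by rewrite card_bad_pairs -sum_nat_const; apply: leq_sum => v /umin.
pose X := [set v in D | f v != dihedral_map false (u^-1 * f u) v].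
pose Y := [set v in D | f v != dihedral_map true (u * f u) v].
have rX : r <= #|X| by apply: far.
have rY : r <= #|Y| by apply: far.
have fX v : v \in D -> v \notin X -> f v = v * (u^-1 * f u).
  by move=> vD; rewrite inE vD negbK => /eqP.
have fY v : v \in D -> v \notin Y -> f v = v^-1 * (u * f u).
  by move=> vD; rewrite inE vD negbK => /eqP.
have XY v : v \in D -> v \notin Z u -> (v \notin X) || (v \notin Y).
  move=> vD; rewrite !inE vD /= => /bad_pairPn[] /(congr1 invg);
    rewrite !invMg !invgK => /(canRL (mulgKV _)) ->; rewrite /dihedral_map;
    apply/orP; [left|right]; rewrite negbK.
    by rewrite mulgA.
  by rewrite mulgA (mC u).
have X_inv x : x \in X :\: Z u -> [/\ x \in D, f x = x^-1 * (u * f u) & x * x <> u * u].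
  rewrite inE => /andP[xZ xX]; have xD : x \in D by move: xX; rewrite inE => /andP[].
  have := XY x xD xZ; rewrite xX /= => xY; split=> //; first exact: fY.
  move/(sqr_eqP _ _ (f u)) => E; move: xX.
  by rewrite inE xD /= (fY x xD xY) -E eqxx.
have Y_id y : y \in Y :\: Z u -> [/\ y \in D, f y = y * (u^-1 * f u) & y * y <> u * u].
  rewrite inE => /andP[yZ yY]; have yD : y \in D by move: yY; rewrite inE => /andP[].
  have := XY y yD yZ; rewrite yY orbF => yX; split=> //; first exact: fX.
  move/(sqr_eqP _ _ (f u)) => E; move: yY.
  by rewrite inE yD /= (fX y yD yX) E eqxx.
have XD : #|X| <= #|D| by apply/subset_leq_card/subsetP=> x; rewrite inE => /andP[].
case: spr => [exp2|half].
  have XZ : X \subset Z u.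
    apply/subsetP=> x xX; apply: contraT => xZ.
    have [|_ _ []] := X_inv x; first by rewrite inE xZ.
    by rewrite !exp2.
  have := leq_trans rX (subset_leq_card XZ); move: ZB.
  by clear; nia.
(* A point on both maps has square [u * u], so at least half of [D] lies in [X] or [Y]. *)
have cover_D : #|D| <= #|X| + #|Y| + #|[set v in D | v * v == u * u]|.
  apply: leq_trans (leq_trans (leq_card_setU _ _) (leq_add (leq_card_setU X Y) (leqnn _))).
  apply/subset_leq_card/subsetP=> v vD; rewrite !in_setU; apply: contraT.
  rewrite !negb_or -andbA => /and3P[/(fX v vD) vX /(fY v vD) vY].
  have E : v * v = u * u by apply/(sqr_eqP v u (f u)); rewrite -vX -vY.
  by rewrite inE vD E eqxx.
have rect : (#|X| - #|Z u|) * (#|Y| - #|Z u|) <= #|bad_pairs f D D|.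
  apply: leq_trans (_ : #|X :\: Z u| * #|Y :\: Z u| <= _).
    by apply: leq_mul; rewrite cardsD leq_sub2l ?subset_leq_card ?subsetIr.
  rewrite -cardsX; apply/subset_leq_card/subsetP=> -[x y] /setXP[].
  move=> /X_inv[xD fx nx] /Y_id[yD fy ny].
  by rewrite !inE xD yD (bad_dihedral fx fy nx ny).
have := half (u * u); move: cover_D rect ZB rX rY XD.
move: #|X| #|Y| #|Z u| #|D| #|bad_pairs _ _ _| #|[set _ in D | _]| => a b z d B s.
clear; move=> cov rect ZB ra rb aD hs.
(* If [16 * z < r], each side of the rectangle loses less than a sixteenth; one of [a], [b] is at
   least [d / 4], the other at least [r]. *)
have [big|small] := leqP r (16 * z); first by nia.
have [ab|ba] := leqP a b; nia.
Qed.
End Stability.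

(** * Short certificates for automorphisms outside B *)

Section Wild.
Local Open Scope group_scope.
Variable gT : finGroupType.
Hypothesis mC : @commutative gT gT mulg.
Implicit Types (x y u v w : gT) (D E : {set gT}) (S : {set gT}).

(* Only solutions with four distinct entries are excluded: in groups with many
   square roots, x * x = u * v cannot be avoided greedily. *)
Definition weak_sidon D := forall x y u v, x \in D -> y \in D -> u \in D -> v \in D ->
  x * y = u * v -> ~~ uniq [:: x; y; u; v].

Definition fibers_le m (P : {set gT * gT}) :=
  [forall e in P, #|[set e' in P | pair_class e' == pair_class e]| <= m].

Lemma bad_pairs_neq f E D e : e \in bad_pairs f E D -> e.1 != e.2.
Proof.
rewrite !inE => /andP[_]; apply: contraTneq => ->.
by rewrite /bad_pair !mulgV eqxx.
Qed.

Lemma bad_pairs_mem f E D e : e \in bad_pairs f E D -> e.1 \in E /\ e.2 \in D.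
Proof. by rewrite !inE => /andP[/andP[]]. Qed.

(** The relation [u * v0 = u0 * v] must have a repeated entry: [u = u0] or [v = v0] gives the first
    listed pair, [u = v0] the second, [v = u0] the third. *)
Lemma sidon_quotient D u v u0 v0 : weak_sidon D ->
  u \in D -> v \in D -> u0 \in D -> v0 \in D -> u != v -> u0 != v0 ->
  u * v^-1 = u0 * v0^-1 ->
  (u, v) \in [:: (u0, v0); (v0, v0 * u0^-1 * v0); (u0 * v0^-1 * u0, u0)].
Proof.
move=> sid uD vD u0D v0D nuv nuv0 E.
have Eu : u = u0 * v0^-1 * v by rewrite -E mulgKV.
have Ev : v = v0 * u0^-1 * u by rewrite Eu !mulgA mulgKV mulgV mul1g.
have := sid u v0 u0 v uD v0D u0D vD _.
have -> : u * v0 = u0 * v by rewrite Eu -!mulgA (mC v v0) mulKg.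
move=> /(_ erefl) nuniq.
have [uu0|nuu0] := eqVneq u u0.
  by rewrite Ev uu0 mulgKV mem_head.
have [vv0|nvv0] := eqVneq v v0.
  by rewrite Eu vv0 mulgKV mem_head.
have [uv0|nuv0'] := eqVneq u v0.
  by rewrite Ev uv0 in_cons mem_head orbT.
have [vu0|nvu0] := eqVneq v u0.
  by rewrite Eu vu0 !in_cons eqxx !orbT.
case/negP: nuniq; rewrite /= !in_cons !in_nil !negb_or nuv0' nuu0 nuv /=.
by rewrite (eq_sym v0 u0) nuv0 (eq_sym v0 v) nvv0 (eq_sym u0 v) nvu0.
Qed.

(** At most three pairs share the quotient of [(u0, v0)], and at most three, swapped, its
    inverse. *)
Lemma sidon_fibers f D : weak_sidon D -> fibers_le 6 (bad_pairs f D D).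
Proof.
move=> sid; apply/forall_inP=> -[u0 v0] e0P; have /= n0 := bad_pairs_neq e0P.
have /= [u0D v0D] := bad_pairs_mem e0P.
pose s := [:: (u0, v0); (v0, v0 * u0^-1 * v0); (u0 * v0^-1 * u0, u0)].
apply: leq_trans (_ : #|s ++ [seq (e.2, e.1) | e <- s]| <= _); last exact: card_size.
apply/subset_leq_card/subsetP=> -[u v]; rewrite in_set => /andP[eP].
have n1 : u != v := bad_pairs_neq eP.
have [uD vD] : u \in D /\ v \in D := bad_pairs_mem eP.
move=> /eqP/inv_rep_eq h; 
have [E|E] : u * v^-1 = u0 * v0^-1 \/ u * v^-1 = (u0 * v0^-1)^-1 := h.
  by rewrite mem_cat (sidon_quotient sid uD vD u0D v0D n1 n0 E).
have E' : v * u^-1 = u0 * v0^-1 by apply: invg_inj; rewrite -E invMg invgK.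
rewrite mem_cat; apply/orP; right; apply/mapP; exists (v, u) => //.
by apply: (sidon_quotient sid vD uD u0D v0D _ n0 E'); rewrite eq_sym.
Qed.

(** Bad pairs must start at [w], and [w * v^-1] up to inversion leaves two choices of [v]; the bound
    6 matches [sidon_fibers]. *)
Lemma fixing_fibers f D w : {in D, forall x, f x = x} ->
  fibers_le 6 (bad_pairs f (w |: D) D).
Proof.
move=> fD.
have onlyw u v : (u, v) \in bad_pairs f (w |: D) D -> u = w.
  rewrite !inE /= => /andP[/andP[/orP[/eqP//|uD] vD]].
  by rewrite /bad_pair !fD // eqxx.
apply/forall_inP=> -[u0 v0] e0P; have ? := onlyw _ _ e0P; subst u0.
pose s := [:: (w, v0); (w, w * v0^-1 * w)].
apply: leq_trans (_ : #|s| <= _); last by apply: leq_trans (card_size _) _.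
apply/subset_leq_card/subsetP=> -[u v]; rewrite in_set => /andP[/onlyw ->].
rewrite /pair_class /= => /eqP/inv_rep_eq[].
  by move/mulgI/invg_inj ->; rewrite !inE eqxx.
rewrite invMg invgK => E.
have -> : v = w * v0^-1 * w by apply: invg_inj; rewrite !invMg invgK; apply: (mulgI w); rewrite E mulKVg.
by rewrite !inE eqxx orbT.
Qed.

(** Maps that are the identity off a short list of points are encoded by lists so that they can be
    counted. *)
Definition lookup (t : seq (gT * gT)) x :=
  foldr (fun e y => if x == e.1 then e.2 else y) x t.

Lemma lookup_map (g : gT -> gT) (s : seq gT) x :
  lookup [seq (y, g y) | y <- s] x = if x \in s then g x else x.
Proof.
elim: s => //= y s IH; rewrite inE; case: eqP => [->|_] //=.
Qed.

Definition moved_pairs D (t : seq (gT * gT)) :=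
  bad_pairs (lookup t) ([set x in unzip1 t] :|: D) D.

Definition far_reaching D (t : seq (gT * gT)) :=
  fibers_le 6 (moved_pairs D t) && (#|D| * size t <= 16 * #|moved_pairs D t|).

Lemma eq_bad_pairs f g E D : {in E :|: D, f =1 g} -> bad_pairs f E D = bad_pairs g E D.
Proof.
move=> fg; apply/setP=> -[u v]; rewrite !inE /=; case: (boolP ((u \in E) && (v \in D))) => //= /andP[uE vD].
by rewrite /bad_pair !fg // inE ?uE ?vD ?orbT.
Qed.

(** The list records [p] composed with the inverse of the dihedral map nearest to it on [D]: all
    points of [D] that this composite moves or, if there are none, one moved point outside [D]. *)
Lemma wild_tuple D S (p : gT -> gT) :
  weak_sidon D -> spread_squares D -> 0 < #|D| ->
  inv_closed S ->
  (forall x y, (x * y^-1 \in S) = (p x * (p y)^-1 \in S)) ->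
  (forall e a, exists x, p x != dihedral_map e a x) ->
  exists t : seq (gT * gT),
   [/\ 0 < size t <= #|D|, far_reaching D t & S \in respecting (lookup t) (moved_pairs D t)].
Proof.
move=> sid spr D0 cS pS far.
pose dist (b : bool * gT) := #|[set x in D | p x != dihedral_map b.1 b.2 x]|.
have [[e a] bmin] : exists b, forall b', dist b <= dist b'.
  by case: (arg_minnP dist (erefl : xpredT (false, 1 : gT))) => b _ bmin; exists b => b'; apply: bmin.
pose g x := if e then (p x * a^-1)^-1 else p x * a^-1.
have g_quot x y : g x * (g y)^-1 = if e then (p x * (p y)^-1)^-1 else p x * (p y)^-1.
  have trans z t : z * a^-1 * (t * a^-1)^-1 = z * t^-1 by rewrite invMg invgK mulgA mulgKV.
  by rewrite /g; case: (e); rewrite ?trans // invgK (mC _^-1) trans invMg invgK.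
have gS x y : (x * y^-1 \in S) = (g x * (g y)^-1 \in S).
  by rewrite pS g_quot; case: (e); rewrite ?(inv_closedV _ cS).
have gbad u v : bad_pair g u v = bad_pair p u v.
  by rewrite /bad_pair g_quot; case: (e); rewrite ?inv_repV.
have g_id x : (g x != x) = (p x != dihedral_map e a x).
  by rewrite /g /dihedral_map; case: (e); rewrite ?eqg_invLR divg_eq.
have resp t : {in [set x in unzip1 t] :|: D, lookup t =1 g} ->
    S \in respecting (lookup t) (moved_pairs D t).
  move=> tg; rewrite !inE cS; apply/forall_inP=> -[u v]; rewrite !inE /= => /andP[/andP[uE vD] _].
  by rewrite !tg ?inE ?uE ?vD ?orbT // gS.
have [d0|dpos] := posnP (dist (e, a)).
  have gD : {in D, forall x, g x = x}.
    move=> x xD; apply/eqP; apply: contraTT isT; rewrite g_id => nx.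
    by move/eqP: d0; rewrite cards_eq0 => /eqP/setP/(_ x); rewrite !inE xD nx.
  have [w] := far e a; rewrite -g_id => gw.
  have wD : w \notin D by apply: contraNN gw => /gD ->.
  have lk : lookup [:: (w, g w)] =1 fun x => if x == w then g w else x by [].
  have tg : {in w |: D, lookup [:: (w, g w)] =1 g}.
    by move=> x; rewrite lk inE in_set1; case: eqP => [->//|_ /= /gD].
  exists [:: (w, g w)].
  have Ew : [set x in unzip1 [:: (w, g w)]] = [set w] by apply/setP=> x; rewrite !inE.
  split=> //; last by apply: resp; rewrite Ew.
  rewrite /far_reaching /moved_pairs Ew fixing_fibers ?andTb; last first.
    by move=> x xD; rewrite lk; case: eqP xD => // ->; rewrite (negPf wD).
  (* As [g] fixes [v] but moves [w], the pair [(w, v)] can fail to be bad only if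
     [v * v = g w * w]. *)
  rewrite muln1; pose D' := [set v in D | v * v != g w * w].
  have sub : setX [set w] D' \subset bad_pairs (lookup [:: (w, g w)]) (w |: D) D.
    apply/subsetP=> -[u v] /setXP[/set1P-> /=]; rewrite inE => /andP[vD /eqP nv].
    rewrite !inE eqxx vD /= ; apply: bad_pairI; rewrite !tg ?inE ?eqxx ?vD ?orbT // (gD v vD).
      by move/mulIg => E; rewrite E eqxx in gw.
    move/(canRL (mulgKV _)) => E; apply: nv.
    by rewrite E -!mulgA (mC v w) mulKg.
  have cD : #|D| <= 2 * #|D'|.
    have := cardsID [set v | v * v == g w * w] D.
    have -> : D :\: [set v | v * v == g w * w] = D' by apply/setP=> v; rewrite !inE andbC.
    have -> : D :&: [set v | v * v == g w * w] = [set v in D | v * v == g w * w].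
      by apply/setP=> v; rewrite !inE.
    case: spr => [exp2|half]; last first.
      move=> c; move: (half (g w * w)); rewrite -c; move: #|D'| #|[set _ in D | _]|; clear; lia.
    suff -> : [set v in D | v * v == g w * w] = set0 by rewrite cards0 add0n => <-; rewrite leq_pmull.
    apply/setP=> v; rewrite !inE exp2 -(exp2 w); apply/negP=> /andP[_ /eqP/mulIg E].
    by rewrite -E eqxx in gw.
  have := subset_leq_card sub; rewrite cardsX cards1 mul1n; move: cD; clear; lia.
pose M := [set x in D | g x != x].
have MD : M \subset D by apply/subsetP=> x; rewrite inE => /andP[].
have sM : #|M| = dist (e, a).
  by congr #|pred_of_set _|; apply/setP=> x; rewrite !inE g_id.
exists [seq (x, g x) | x <- enum M].
have EM : [set x in unzip1 [seq (x, g x) | x <- enum M]] = M.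
  by apply/setP=> x; rewrite inE /unzip1 -map_comp map_id mem_enum.
have tg : {in M :|: D, lookup [seq (x, g x) | x <- enum M] =1 g}.
  move=> x; rewrite (setUidPr MD) => xD; rewrite lookup_map mem_enum inE xD /=.
  by case: eqP.
split; last by apply: resp; rewrite EM.
  by rewrite size_map -cardE sM dpos -sM subset_leq_card.
rewrite /far_reaching /moved_pairs EM (setUidPr MD) (eq_bad_pairs (g := g)); last first.
  by rewrite setUid -{1}(setUidPr MD).
rewrite sidon_fibers //= size_map -cardE sM.
have -> : bad_pairs g D D = bad_pairs p D D by apply/setP=> z; rewrite !inE gbad.
by apply: (stability mC spr) => e' a'; apply: (bmin (e', a')).
Qed.
End Wild.

(** * Greedy construction of the test set D *)

Section Existence.
Local Open Scope group_scope.
Variable gT : finGroupType.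
Hypothesis mC : @commutative gT gT mulg.
Implicit Types (x y u v w z : gT) (D E : {set gT}).

Definition sidon_forbidden D : {set gT} :=
  [set t.1.1 * t.1.2 * t.2^-1 | t in setX (setX D D) D].

Lemma card_sidon_forbidden D : #|sidon_forbidden D| <= #|D| ^ 3.
Proof.
apply: leq_trans (leq_imset_card _ _) _.
by rewrite !cardsX (expnSr _ 2).
Qed.

(** A violating equation involves [z], and only once as its entries are distinct; solving for [z]
    puts it in [sidon_forbidden D]. *)
Lemma weak_sidonU1 D z :
  weak_sidon D -> z \notin sidon_forbidden D -> weak_sidon (z |: D).
Proof.
move=> sid nz.
have forb x y u : x \in D -> y \in D -> u \in D -> z * u = x * y -> False.
  move=> xD yD uD E; case/negP: nz; apply/imsetP; exists ((x, y), u).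
    by rewrite !inE xD yD.
  by rewrite /= -E mulgK.
move=> x y u v xD yD uD vD E; apply/negP=> U; move: (U); rewrite /= !inE !negb_or.
case/and4P=> /and3P[nxy nxu nxv] /andP[nyu nyv] nuv _.
have neq a b : a \in z |: D -> a != b -> b = z -> a \in D.
  by rewrite in_setU1 => /orP[/eqP->|//] /eqP nab ba; case: nab.
have [xz|xz] := eqVneq x z.
  rewrite xz in E; apply: (forb u v y _ _ _ E).
  - by apply: (neq u x uD _ xz); rewrite // eq_sym.
  - by apply: (neq v x vD _ xz); rewrite // eq_sym.
  - by apply: (neq y x yD _ xz); rewrite // eq_sym.
have [yz|yz] := eqVneq y z.
  rewrite yz mC in E; apply: (forb u v x _ _ _ E).
  - by apply: (neq u y uD _ yz); rewrite // eq_sym.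
  - by apply: (neq v y vD _ yz); rewrite // eq_sym.
  - by apply: (neq x y xD _ yz); rewrite // eq_sym.
have [uz|uz] := eqVneq u z.
  rewrite uz in E; apply: (forb x y v _ _ _ (esym E)).
  - by apply: (neq x u xD _ uz); rewrite // eq_sym.
  - by apply: (neq y u yD _ uz); rewrite // eq_sym.
  - by apply: (neq v u vD _ uz); rewrite // eq_sym.
have [vz|vz] := eqVneq v z.
  rewrite vz (mC u) in E; apply: (forb x y u _ _ _ (esym E)).
  - by apply: (neq x v xD _ vz); rewrite // eq_sym.
  - by apply: (neq y v yD _ vz); rewrite // eq_sym.
  - by apply: (neq u v uD _ vz); rewrite // eq_sym.
have old a : a \in z |: D -> a != z -> a \in D by rewrite in_setU1 => /orP[/eqP->|//]; rewrite eqxx.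
by have := sid x y u v (old _ xD xz) (old _ yD yz) (old _ uD uz) (old _ vD vz) E; rewrite U.
Qed.

(** Multiplying by [y] changes the square by [y * y], so the fibre and its translate are
    disjoint. *)
Lemma card_square_fiber y (s : gT) : y * y <> 1 -> 2 * #|[set x | x * x == s]| <= #|gT|.
Proof.
move=> ny; pose F := [set x | x * x == s].
have dis : F :&: [set x * y | x in F] = set0.
  apply/setP=> z; rewrite !inE; apply/negP=> /andP[/eqP zs /imsetP[x]].
  rewrite inE => /eqP xs zx; apply: ny; apply: (mulgI s); rewrite mulg1 -{2}zs zx -xs.
  by rewrite -!mulgA (mulgA y x) (mC y x) !mulgA.
have := cardsUI F [set x * y | x in F]; rewrite dis cards0 addn0.
rewrite (card_imset _ (mulIg y)) => E.
by rewrite mul2n -addnn -E max_card.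
Qed.

Lemma exists_notin (X : {set gT}) : #|X| < #|gT| -> exists z, z \notin X.
Proof.
move=> h; have : 0 < #|~: X| by rewrite -(ltn_add2l #|X|) cardsC addn0.
by case/card_gt0P=> z; rewrite inE; exists z.
Qed.

(** Outside exponent 2, points are added two at a time with different squares, so each square value
    gains at most one. Fewer than half of the elements are lost to the Sidon condition and
    membership, at most half to the square of the partner. *)
Lemma exists_spread_sidon k :
  2 * ((2 * k) ^ 3 + 2 * k) < #|gT| ->
  exists D, [/\ weak_sidon D, spread_squares D & #|D| = (2 * k)%N].
Proof.
move=> big.
suff [D [sid spr cD]] : exists D, [/\ weak_sidon D,
    (forall x, x * x = 1) \/ (forall s, #|[set x in D | x * x == s]| <= k) & #|D| = (2 * k)%N].
  exists D; split=> //; case: spr => [|h]; [by left|right] => s.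
  by rewrite cD leq_mul2l h orbT.
elim: k big => [|k IH] big.
  exists set0; rewrite cards0; split=> // [x y u v|]; first by rewrite inE.
  right=> s; rewrite leqn0 cards_eq0; apply/eqP/setP=> x; by rewrite !inE.
case: IH => [|D [sid spr cD]]; first by apply: leq_ltn_trans big; rewrite leq_mul2l leq_add ?leq_exp2r //; lia.
have bnd X : #|X :|: sidon_forbidden X| <= #|X| ^ 3 + #|X|.
  by rewrite addnC; apply: leq_trans (leq_card_setU _ _) _; rewrite leq_add2l card_sidon_forbidden.
have [z2] : exists z, z \notin D :|: sidon_forbidden D.
  apply: exists_notin; apply: leq_ltn_trans (bnd D) _; rewrite cD.
  apply: leq_ltn_trans big; apply: leq_trans (leq_pmull _ _) => //.
  by rewrite leq_add ?leq_exp2r //; lia.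
rewrite in_setU negb_or => /andP[z2D z2f].
have sid2 := weak_sidonU1 sid z2f.
have cD2 : #|z2 |: D| = (2 * k).+1%N by rewrite cardsU1 z2D cD.
have bnd2 : 2 * #|(z2 |: D) :|: sidon_forbidden (z2 |: D)| < #|gT|.
  apply: leq_ltn_trans big; rewrite leq_mul2l; apply: leq_trans (bnd _) _.
  by rewrite cD2 leq_add ?leq_exp2r //; lia.
pose bad1 := if [forall x : gT, x * x == 1] then set0 else [set x | x * x == z2 * z2].
have cbad : 2 * #|bad1| <= #|gT|.
  rewrite /bad1; case: ifPn; first by rewrite cards0.
  by rewrite negb_forall => /existsP[y /eqP/card_square_fiber].
have [z1] : exists z, z \notin ((z2 |: D) :|: sidon_forbidden (z2 |: D)) :|: bad1.
  apply: exists_notin; apply: leq_ltn_trans (leq_card_setU _ _) _.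
  by move: bnd2 cbad; set a := #|_|; set b := #|bad1|; clearbody a b; clear; lia.
rewrite in_setU negb_or => /andP[]; rewrite in_setU negb_or => /andP[z1D z1f] z1b.
exists (z1 |: (z2 |: D)); split.
- exact: weak_sidonU1.
- case: (boolP [forall x : gT, x * x == 1]) => [/forallP h|h]; first by left=> x; apply/eqP.
  case: spr => [h'|spr]; first by left.
  right=> s; rewrite /bad1 (negPf h) inE in z1b.
  apply: leq_trans (_ : #|(if z1 * z1 == s then [set z1] else [set z2]) :|: [set x in D | x * x == s]| <= _).
    apply/subset_leq_card/subsetP=> x; rewrite !inE.
    case/andP=> /or3P[/eqP->|/eqP->|xD] xs; rewrite ?xs ?inE ?eqxx //.
      by rewrite -(eqP xs) (negPf z1b) inE eqxx.
    by rewrite xD orbT.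
  apply: leq_trans (leq_card_setU _ _) _; rewrite -(add1n k).
  by apply: leq_add => //; case: ifP; rewrite cards1.
- by rewrite cardsU1 z1D cD2; lia.
Qed.
End Existence.

(** * Union bound over certificates *)

Section Union.
Local Open Scope group_scope.
Variable gT : finGroupType.
Hypothesis mC : @commutative gT gT mulg.

Definition wild_sets : {set {set gT}} :=
  [set S in cay_sets gT | [exists p : {perm gT}, (p \in cay_aut S) &&
     [forall b : bool * gT, exists x, p x != dihedral_map b.1 b.2 x]]].

Lemma leq_card_bigcup (I T : finType) (F : I -> {set T}) :
  #|\bigcup_i F i| <= \sum_i #|F i|.
Proof.
elim/big_rec2: _ => [|i m X _ h]; first by rewrite cards0.
by apply: leq_trans (leq_card_setU _ _) _; rewrite leq_add2l.
Qed.

(** There are at most [2 ^ (a * (r + 1))] lists of length [r + 1], each admitting at most a fraction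
    [2 ^ -(e * (r + 1))] of the sets. As [a <= e], each of the [#|D|] lengths contributes at most
    [2 ^ -(e - a)]. *)
Lemma card_wild_sets (D : {set gT}) e a :
  weak_sidon D -> spread_squares D -> 0 < e -> #|D| = (192 * e)%N ->
  #|gT| ^ 2 <= 2 ^ a -> a <= e ->
  #|wild_sets| * 2 ^ (e - a) <= #|D| * #|cay_sets gT|.
Proof.
move=> sid spr e0 cD na ae.
pose X (t : seq (gT * gT)) :=
  if far_reaching D t then respecting (lookup t) (moved_pairs D t) else set0.
have cX t : #|X t| * 2 ^ (e * size t) <= #|cay_sets gT|.
  rewrite /X; case: ifP => [/andP[fib big]|_]; last by rewrite cards0.
  (* The constant 192 is [16 * 2 * 6]: 16 from [far_reaching], the rest from [2 * m] with
     [m = 6]. *)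
  apply: (@card_respecting _ _ _ 6) => //.
  - by move=> z; rewrite inE => /andP[].
  - exact/forall_inP.
  - by move: big; rewrite cD -mulnA; move: (e * size t)%N #|_| => b c; clear; lia.
have cover_W : wild_sets \subset \bigcup_(r < #|D|) \bigcup_(t : r.+1.-tuple (gT * gT)) X t.
  apply/subsetP=> S; rewrite inE => /andP[SC /existsP[p /andP[pS /forallP far]]].
  have [||x y|b c|t [/andP[t0 tD] ft rt]] := @wild_tuple _ mC D S p sid spr.
  - by rewrite cD; lia.
  - by move: SC; rewrite inE.
  - by move: pS; rewrite inE => /forallP/(_ x)/forallP/(_ y)/eqP.
  - by have /existsP := far (b, c).
  (* Lists are nonempty, so the index [r < #|D|] stands for length [r + 1]. *)
  have tD' : (size t).-1 < #|D| by rewrite prednK.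
  apply/bigcupP; exists (Ordinal tD') => //; apply/bigcupP.
  have st : size t == (Ordinal tD').+1 by rewrite /= prednK.
  by exists (Tuple st); rewrite // /X /= ft.
apply: leq_trans (_ : (\sum_(r < #|D|) #|cay_sets gT|) <= _); last first.
  by rewrite sum_nat_const card_ord.
apply: leq_trans (_ : (\sum_(r < #|D|) #|\bigcup_(t : r.+1.-tuple (gT * gT)) X t|) * 2 ^ (e - a) <= _).
  rewrite leq_mul2r; apply/orP; right.
  by apply: leq_trans (subset_leq_card cover_W) (leq_card_bigcup _).
rewrite big_distrl /=; apply: leq_sum => r _.
rewrite -(leq_pmul2r (expn_gt0 2 (a * r.+1))).
apply: leq_trans (_ : (\sum_(t : r.+1.-tuple (gT * gT)) #|X t|) * 2 ^ (e * r.+1) <= _).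
  rewrite -mulnA -expnD leq_mul ?leq_card_bigcup // leq_exp2l //.
  by rewrite -(leq_add2r (a * r)); nia.
rewrite big_distrl /=; apply: leq_trans (_ : \sum_(t : r.+1.-tuple (gT * gT)) #|cay_sets gT| <= _).
  by apply: leq_sum => t _; rewrite -{2}(size_tuple t).
rewrite sum_nat_const card_tuple mulnC leq_mul2l; apply/orP; right.
by rewrite card_prod mulnn expnM leq_exp2r.
Qed.
End Union.

(** * Automorphisms and isomorphism classes of the sets that are not wild *)

Section Classes.
Local Open Scope group_scope.
Variable gT : finGroupType.
Hypothesis mC : @commutative gT gT mulg.
Implicit Types (S T : {set gT}) (p q : {perm gT}) (a x y : gT).

Lemma cay_autP S p :
  reflect (forall x y, cay_rel S x y = cay_rel S (p x) (p y)) (p \in cay_aut S).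
Proof.
rewrite inE; apply: (iffP forallP) => [h x y|h x].
  by apply/eqP; have /forallP := h x; apply.
by apply/forallP=> y; rewrite h.
Qed.

Lemma cay_isoP S T :
  reflect (exists p, forall x y, cay_rel S x y = cay_rel T (p x) (p y)) (cay_iso S T).
Proof.
apply: (iffP existsP) => -[p h]; exists p.
  by move=> x y; apply/eqP; have /forallP/(_ x)/forallP := h; apply.
by apply/forallP=> x; apply/forallP=> y; rewrite h.
Qed.

Lemma cay_aut_group_set S : group_set (cay_aut S).
Proof.
apply/group_setP; split=> [|p q /cay_autP pS /cay_autP qS]; apply/cay_autP=> x y.
  by rewrite !perm1.
by rewrite !permM -qS -pS.
Qed.

Lemma rtrans_aut S a : rtrans a \in cay_aut S.
Proof. by apply/cay_autP=> x y; rewrite /cay_rel !permE invMg mulgA mulgK. Qed.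

Lemma Bgrp_sub_aut S : inv_closed S -> Bgrp gT \subset cay_aut S.
Proof.
move=> cS; rewrite -[cay_aut S]/(gval (Group (cay_aut_group_set S))) gen_subG subUset /=.
apply/andP; split; first by apply/subsetP=> _ /imsetP[a _ ->]; apply: rtrans_aut.
rewrite sub1set; apply/cay_autP=> x y.
by rewrite /cay_rel !permE -(inv_closedV _ cS) invMg invgK mC.
Qed.

Lemma dihedral_in_Bgrp p e a : p =1 dihedral_map e a -> p \in Bgrp gT.
Proof.
move=> pE; have ra : rtrans a \in Bgrp gT by rewrite mem_gen // inE imset_f.
have io : iota_perm gT \in Bgrp gT by rewrite mem_gen // !inE eqxx orbT.
have -> : p = (if e then iota_perm gT else 1) * rtrans a.
  by apply/permP=> x; rewrite pE permM permE; case: (e); rewrite ?permE ?perm1.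
by rewrite groupM //; case: (e).
Qed.

Lemma tame_aut_dihedral S p : S \in cay_sets gT -> S \notin wild_sets gT ->
  p \in cay_aut S -> exists b : bool * gT, p =1 dihedral_map b.1 b.2.
Proof.
move=> SC; rewrite inE SC negb_exists => /forallP/(_ p) + pS.
rewrite pS negb_forall => /existsP[b]; rewrite negb_exists => /forallP h.
by exists b => x; apply/eqP; rewrite -[_ == _]negbK h.
Qed.

Lemma tame_aut S : S \in cay_sets gT -> S \notin wild_sets gT -> cay_aut S = Bgrp gT.
Proof.
move=> SC Sw; apply/eqP; rewrite eqEsubset Bgrp_sub_aut ?andbT; last by move: SC; rewrite inE.
apply/subsetP=> p pS; have [b pb] := tame_aut_dihedral SC Sw pS.
exact: dihedral_in_Bgrp pb.
Qed.

(** By Lagrange each new generator at least doubles the generated subgroup. *)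
Lemma small_generating_seq :
  exists s : seq gT, 2 ^ size s <= #|gT| /\ <<[set x in s]>> = [set: gT].
Proof.
suff step k : exists s : seq gT, 2 ^ size s <= #|<<[set x in s]>>| /\
    (<<[set x in s]>> = [set: gT] \/ size s = k).
  have [s [bs [gs|sk]]] := step #|gT|; first by exists s; rewrite gs cardsT in bs *.
  have := leq_trans bs (max_card _); rewrite sk leqNgt ltn_expl //.
elim: k => [|k [s [bs [gs|sk]]]].
- by exists [::]; split; [rewrite cardG_gt0 | right].
- by exists s; split=> //; left.
have [gs|] := eqVneq <<[set x in s]>> [set: gT].
  by exists s; split=> //; left.
rewrite -subTset => /subsetPn[z _ zs]; exists (z :: s); split; last by right; rewrite /= sk.
have sub : <<[set x in s]>> \subset <<[set x in z :: s]>>.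
  by apply/genS/subsetP=> x; rewrite !inE orbC => ->.
have zz : z \in <<[set x in z :: s]>> by rewrite mem_gen // !inE eqxx.
have /dvdnP[m E] := cardSg sub.
have prop : #|<<[set x in s]>>| < #|<<[set x in z :: s]>>|.
  by apply/proper_card/properP; split=> //; exists z.
move: prop; rewrite E /= expnS => prop; rewrite leq_mul //.
by case: m {E} prop => [|[|m]] //; rewrite ?mul0n ?mul1n ?ltnn.
Qed.

Lemma rtransM a b : rtrans (a * b) = rtrans a * rtrans b.
Proof. by apply/permP=> x; rewrite permM !permE mulgA. Qed.

(** The [a] at which the conjugates agree form a subgroup, hence the whole group; the conjugate of
    [rtrans a] by [p] sends [p 1] to [p a]. *)
Lemma rtrans_conj_eq (s : seq gT) p q :
  <<[set x in s]>> = [set: gT] ->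
  {in s, forall a, rtrans a ^ p = rtrans a ^ q} -> p 1 = q 1 -> p = q.
Proof.
move=> gen_s eq_s eq1; pose H := [set a | rtrans a ^ p == rtrans a ^ q].
have gH : group_set H.
  apply/group_setP; split=> [|a b]; rewrite !inE.
    by have -> : rtrans (1 : gT) = 1; rewrite ?conj1g //; apply/permP=> x; rewrite permE perm1 mulg1.
  by rewrite rtransM !conjMg => /eqP-> /eqP->.
have HT : [set: gT] \subset Group gH.
  by rewrite -gen_s gen_subG; apply/subsetP=> a; rewrite !inE => /eq_s ->.
apply/permP=> a; have := subsetP HT a (in_setT a); rewrite inE => /eqP/permP/(_ (p 1)).
by rewrite {2}eq1 !permJ !permE mul1g.
Qed.

Lemma pointed_iso S T : cay_iso S T -> exists p, p 1 = 1 /\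
  forall x y, cay_rel S x y = cay_rel T (p x) (p y).
Proof.
case/cay_isoP=> p pST; exists (p * rtrans (p 1)^-1).
split=> [|x y]; first by rewrite permM permE mulgV.
by rewrite !permM pST; apply/cay_autP/rtrans_aut.
Qed.

Definition cay_class S := [set T in cay_sets gT | cay_iso S T].

(* A based isomorphism out of [Cay(A, S)] is determined by the automorphisms of
   [Cay(A, S)] to which it conjugates a generating set of translations. *)
Lemma card_iso_class S (s : seq gT) :
  S \in cay_sets gT -> S \notin wild_sets gT -> <<[set x in s]>> = [set: gT] ->
  #|cay_class S| <= (2 * #|gT|) ^ size s.
Proof.
move=> SC Sw gen_s.
pose based T p := (p 1 == 1) &&
  [forall x, forall y, cay_rel S x y == cay_rel T (p x) (p y)].
(* The default [1] is never reached when [cay_iso S T] holds. *)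
pose iso T : {perm gT} := odflt 1 [pick p | based T p].
have isoP T : cay_iso S T -> iso T 1 = 1 /\
    forall x y, cay_rel S x y = cay_rel T (iso T x) (iso T y).
  case/pointed_iso=> p [p1 pST]; rewrite /iso; case: pickP => [q|/(_ p)] /=.
    case/andP=> /eqP q1 /forallP h; split=> // x y.
    by apply/eqP; have /forallP := h x; apply.
  rewrite /based p1 eqxx /= => /negbT/negP[].
  by apply/forallP=> x; apply/forallP=> y; rewrite pST.
pose code1 T a : bool * gT := odflt (false, 1)
  [pick b | [forall x, (rtrans a ^ (iso T)^-1) x == dihedral_map b.1 b.2 x]].
have code1P T a : cay_iso S T ->
    rtrans a ^ (iso T)^-1 =1 dihedral_map (code1 T a).1 (code1 T a).2.
  move=> /isoP[_ h].
  have : rtrans a ^ (iso T)^-1 \in cay_aut S.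
    apply/cay_autP=> x y; rewrite /conjg invgK !permM !h !permKV.
    by apply/cay_autP/rtrans_aut.
  case/(tame_aut_dihedral SC Sw) => b hb.
  rewrite /code1; case: pickP => [c /forallP hc x|/(_ b)/negbT/negP[]]; first exact/eqP.
  by apply/forallP=> x; rewrite hb.
pose code T := map_tuple (code1 T) (in_tuple s).
have -> : (2 * #|gT|)%N = #|{: bool * gT}| by rewrite card_prod card_bool.
rewrite -card_tuple.
suff inj : {in cay_class S &, injective code}.
  by rewrite -(card_in_imset inj) max_card.
move=> T U; rewrite !inE => /andP[_ ST] /andP[_ SU] /(congr1 val) /= /eq_in_map E.
have [T1 hT] := isoP T ST; have [U1 hU] := isoP U SU.
have eq_iso : (iso T)^-1 = (iso U)^-1.
  apply: (rtrans_conj_eq gen_s) => [a aS|].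
    by apply/permP=> x; rewrite (code1P T a ST) (code1P U a SU) (E a aS).
  by rewrite -{1}T1 -{2}U1 !permK.
(* Membership in [V] is adjacency to the identity, so [S] and [iso V] determine [V]. *)
have mem V : iso V 1 = 1 -> (forall x y, cay_rel S x y = cay_rel V (iso V x) (iso V y)) ->
    forall x, (x \in V) = ((iso V)^-1 x \in S).
  move=> V1 hV x; have := hV ((iso V)^-1 x) 1.
  by rewrite V1 permKV /cay_rel invg1 !mulg1.
by apply/setP=> x; rewrite (mem T) // (mem U) // eq_iso.
Qed.

Lemma cay_iso_refl S : cay_iso S S.
Proof. by apply/cay_isoP; exists 1 => x y; rewrite !perm1. Qed.

Lemma cay_classesE : cay_classes gT = cay_class @: cay_sets gT.
Proof. by []. Qed.

(** A class with a member that is not wild is good, so every other class is the class of a wild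
    set. *)
Lemma card_not_good : #|cay_classes gT| <= #|good_classes gT| + #|wild_sets gT|.
Proof.
apply: leq_trans (_ : #|good_classes gT :|: cay_class @: wild_sets gT| <= _).
  apply/subset_leq_card/subsetP=> C CC; rewrite in_setU.
  case/imsetP: (CC) => S SC CE.
  have [Sw|Sw] := boolP (S \in wild_sets gT); first by rewrite CE (imset_f cay_class Sw) orbT.
  rewrite inE CC; apply/orP; left; apply/existsP; exists S.
  by rewrite CE inE SC cay_iso_refl tame_aut ?eqxx.
by apply: leq_trans (leq_card_setU _ _) _; rewrite leq_add2l leq_imset_card.
Qed.

Lemma card_tame (s : seq gT) : <<[set x in s]>> = [set: gT] ->
  #|cay_sets gT| <= #|wild_sets gT| + (2 * #|gT|) ^ size s * #|cay_classes gT|.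
Proof.
move=> gen_s; rewrite -(cardsID (wild_sets gT)); apply: leq_add.
  by apply/subset_leq_card/subsetP=> S; rewrite inE => /andP[].
apply: leq_trans (leq_card_fibers (h := cay_class) (m := (2 * #|gT|) ^ size s) _) _; last first.
  rewrite leq_mul2l; apply/orP; right; apply: subset_leq_card.
  by rewrite cay_classesE; apply/imsetS/subsetDl.
move=> S; rewrite in_setD => /andP[Sw SC]; apply: leq_trans (card_iso_class SC Sw gen_s).
apply/subset_leq_card/subsetP=> T; rewrite inE => /andP[/setDP[TC _] /eqP E].
have : T \in cay_class T by rewrite inE TC cay_iso_refl.
by rewrite E.
Qed.

Lemma good_classes_sub : #|good_classes gT| <= #|cay_classes gT|.
Proof. by apply/subset_leq_card/subsetP=> C; rewrite inE => /andP[]. Qed.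

End Classes.

(** * Numerical estimates in the logarithm of the order *)

Lemma sidon_size_bound l : 2 ^ 7 <= l ->
  2 * ((192 * l ^ 3) ^ 3 + 192 * l ^ 3) < 2 ^ l.
Proof.
move=> l7; have l0 : 0 < l by apply: leq_trans l7.
have /andP[jl lj] := trunc_log_bounds (isT : 1 < 2) l0.
set j := trunc_log 2 l in jl lj.
have j7 : 7 <= j by apply: trunc_log_max.
(* The left side will be bounded by [2 ^ (9 * j + 35)]; from [j = 7] on, this exponent is below
   [2 ^ j <= l]. *)
have pow m : 9 * (7 + m) + 36 <= 2 ^ (7 + m).
  elim: m => [//|m IH]; rewrite addnS expnS; move: (2 ^ _)%N IH => A; lia.
have big : 9 * j + 36 <= l by apply: leq_trans jl; rewrite -(subnKC j7).
have d8 : 192 * l ^ 3 < 2 ^ (3 * j + 11).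
  have -> : 3 * j + 11 = 8 + j.+1 * 3 by lia.
  by rewrite expnD expnM; apply: ltn_mul; rewrite ?ltn_exp2r.
set d := (192 * l ^ 3)%N in d8 *.
have d0 : 0 < d by rewrite muln_gt0 expn_gt0 l0.
apply: leq_ltn_trans (_ : 4 * d ^ 3 < _).
  have : d <= d ^ 3 by rewrite -{1}(expn1 d) leq_pexp2l.
  by move: (d ^ 3)%N => D; lia.
apply: leq_trans (_ : 2 ^ 2 * 2 ^ ((3 * j + 11) * 3) <= _).
  by rewrite ltn_pmul2l // expnM ltn_exp2r.
by rewrite -expnD leq_exp2l //; lia.
Qed.

Lemma good_classes_asymptotics (gT : finGroupType) l :
  abelian [set: gT] -> 2 ^ 7 <= l -> 2 ^ l <= #|gT| < 2 ^ l.+1 ->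
  (#|cay_classes gT| - #|good_classes gT|) * 2 ^ l <= #|cay_classes gT|.
Proof.
move=> ab l7 /andP[nl nu].
have mC : @commutative gT gT mulg.
  by move=> x y; apply: (centsP ab); rewrite inE.
have l0 : 0 < l by apply: leq_trans l7.
(* The summands pay, in order, for [#|gT| ^ 2] in the union bound, for [#|D|], for twice the largest
   class size, and for the final gain [2 ^ l]. *)
have expo : 2 * l.+1 + l.+1 + (1 + l.+2 * l) + l <= l ^ 3.
  by rewrite !expnS expn0 muln1; have := leq_trans (isT : 7 <= 2 ^ 7) l7; clear; nia.
have [] := @exists_spread_sidon gT mC (96 * l ^ 3).
  by rewrite mulnA; apply: leq_trans nl; apply: sidon_size_bound.
move=> D [sid spr]; rewrite mulnA => cD.
have na : #|gT| ^ 2 <= 2 ^ (2 * l.+1) by rewrite mulnC expnM leq_exp2r // ltnW.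
have ae : 2 * l.+1 <= l ^ 3 by apply: leq_trans expo; lia.
have e0 : 0 < l ^ 3 by rewrite expn_gt0 l0.
have cW := card_wild_sets mC sid spr e0 cD na ae.
have [s [bs gen_s]] := small_generating_seq gT.
have cs : size s <= l.
  by rewrite -ltnS -(ltn_exp2l _ _ (isT : 1 < 2)); apply: leq_ltn_trans bs nu.
have tame := card_tame gen_s.
have notgood := @card_not_good gT mC.
have iso_bound : (2 * #|gT|) ^ size s <= 2 ^ (l.+2 * l).
  rewrite expnM; apply: leq_trans (leq_pexp2l _ cs) _.
    by rewrite muln_gt0 /= (leq_trans _ nl) // expn_gt0.
  by rewrite leq_exp2r // expnS leq_mul // ltnW.
have cD' : #|D| <= 2 ^ l.+1 by apply: leq_trans (max_card _) (ltnW nu).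
have cS : 0 < #|cay_sets gT| by apply: leq_trans (card_cay_sets_ge gT); rewrite expn_gt0.
move: cW tame notgood iso_bound.
move: (#|wild_sets gT|) (#|cay_sets gT|) (#|cay_classes gT|) (#|good_classes gT|) (_ ^ size s)
  => W T c g L cW tame notgood Lb.
set m := 1 + l.+2 * l in expo.
have Wm : W * 2 ^ (m + l) <= T.
  rewrite -(leq_pmul2l (expn_gt0 2 l.+1)) mulnCA -expnD.
  apply: leq_trans (leq_trans cW (leq_mul cD' (leqnn T))).
  by rewrite leq_mul2l leq_exp2l // orbC; move: expo; clear; lia.
have W2 : W * 2 <= T.
  by apply: leq_trans Wm; rewrite leq_mul2l -{1}(expn1 2) leq_exp2l // orbT.
(* At most half of the sets are wild, so [T <= 2 * (L * c)]. *)
have Tc : T <= 2 ^ m * c.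
  rewrite expnS -mulnA; have := leq_mul Lb (leqnn c); move: tame W2.
  by move: (L * c) (_ * c) => A B; clear; lia.
apply: leq_trans (_ : W * 2 ^ l <= _).
  by rewrite leq_mul2r leq_subLR notgood orbT.
rewrite -(leq_pmul2l (expn_gt0 2 m)); apply: leq_trans Tc.
by rewrite mulnCA -expnD.
Qed.

(** * Passage to the limit *)

Local Open Scope ring_scope.

Theorem theorem6p2 :
  forall eps : rat, 0 < eps ->
  exists N : nat,
  forall gT : finGroupType,
    abelian [set: gT] -> (N <= #|gT|)%N ->
    `| (#|good_classes gT|%:R / #|cay_classes gT|%:R : rat) - 1 | < eps.
Proof.
move=> eps eps0; pose k := Num.bound eps^-1.
(* The summand [2 ^ 7] makes the estimates available; [k > eps^-1] gives [2 ^ l > eps^-1]. *)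
exists (2 ^ (2 ^ 7 + k))%N => gT ab big.
have n0 : (0 < #|gT|)%N by apply: leq_trans big; rewrite expn_gt0.
have bounds := trunc_log_bounds (isT : (1 < 2)%N) n0.
set l := trunc_log 2 #|gT| in bounds.
have kl : (2 ^ 7 + k <= l)%N by apply: trunc_log_max.
have := good_classes_asymptotics ab (leq_trans (leq_addr _ _) kl) bounds.
have gc := good_classes_sub gT.
have c0 : (0 < #|cay_classes gT|)%N.
  rewrite card_gt0; apply/set0Pn; exists (cay_class set0); rewrite cay_classesE imset_f // inE.
  by apply/forallP=> x; rewrite !inE.
move: (#|good_classes gT|) (#|cay_classes gT|) gc c0 => g c gc c0 close.
have cQ : 0 < c%:R :> rat by rewrite ltr0n.
have -> : g%:R / c%:R - 1 = - ((c - g)%N%:R / c%:R) :> rat.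
  by rewrite natrB // mulrBl divff ?gt_eqF // opprB.
rewrite normrN ger0_norm ?divr_ge0 ?ler0n // ltr_pdivrMr //.
have pow_eps : 1 < eps * (2 ^ l)%:R.
  rewrite -(ltr_pdivrMl _ _ eps0) mulr1; apply: lt_le_trans (archi_boundP _) _.
    by rewrite invr_ge0 ltW.
  rewrite ler_nat; apply: leq_trans (_ : l <= _)%N; last exact/ltnW/ltn_expl.
  by apply: leq_trans kl; rewrite leq_addl.
have p0 : 0 < (2 ^ l)%:R :> rat by rewrite ltr0n expn_gt0.
rewrite -(ltr_pM2r p0) -natrM; apply: le_lt_trans (_ : c%:R < _).
  by rewrite ler_nat.
by rewrite mulrAC -{1}(mul1r c%:R) ltr_pM2r.
Qed.
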